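(* Let $\theta_0\in\mathbb R^p$, let $\hat\theta$ be a random vector in $\mathbb R^p$, let $\alpha\in(0,1)$ and let $\lambda>0$ satisfy $$\lambda\ge(1-\alpha)\text{-quantile of }\|\hat\theta-\theta_0\|_\infty.$$ Let $\tilde\theta$ be the $\ell_1$-regularized estimator $$\tilde\theta=\arg\min_{\theta\in\mathbb R^p}\|\theta\|_1\ \text{ subject to }\ \|\hat\theta-\theta\|_\infty\le\lambda .$$ Then with probability at least $1-\alpha$, we have $|\tilde\theta_j|\le|\theta_{0j}|$ and $|\tilde\theta_j-\theta_{0j}|\le2\lambda$ for all $j\in[p]$, and (i) under Condition DM: $\|\tilde\theta-\theta_0\|_q\le2K^{1/q}\lambda^{1-1/q}$ if $q\ge1$; (ii) under Condition ES: $\|\tilde\theta-\theta_0\|_q\le2s^{1/q}\lambda$ if $q\ge1$, and $\tilde\theta_j=0$ for all $j\notin T$; (iii) under Condition AS: $\|\tilde\theta-\theta_0\|_q\le C_{a,q}s^{1/q}\lambda$ if $q>a^{-1}$, where $s=\lceil(A/\lambda)^{1/a}\rceil$, where $C_{a,q}$ is a constant depending only on $a$ and $q$.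
   Context: $[p]=\{1,\dots,p\}$ and $\|x\|_q=(\sum_{j=1}^p|x_j|^q)^{1/q}$. The solution is explicit: $\tilde\theta_j=(|\hat\theta_j|-\lambda)_+\,\mathrm{sign}(\hat\theta_j)$, with $(u)_+=u1\{u>0\}$. Condition ES (exact sparsity): there exists $T\subset\{1,\dots,p\}$ with cardinality $s$ such that $\theta_{0j}\ne0$ only for $j\in T$. Condition AS (approximate sparsity): for some $A>0$ and $a>1/2$, the non-increasing rearrangement $(|\theta_0|_j^* )_{j\in[p]}$ of $(|\theta_{0j}|)_{j\in[p]}$ obeys $|\theta_0|_j^*\le Aj^{-a}$ for all $j\in[p]$. Condition DM (dense model): $\|\theta_0\|_1\le K$ for some $K>0$. *)

(* Defs.v *)
From HB Require Import structures.
From mathcomp Require Import all_boot all_order all_algebra.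
From mathcomp Require Import all_classical all_reals all_analysis.

Set Implicit Arguments.
Unset Strict Implicit.
Unset Printing Implicit Defensive.

Import Order.TTheory GRing.Theory Num.Theory.
Import numFieldNormedType.Exports.

Local Open Scope classical_set_scope.
Local Open Scope ring_scope.

(* Vectors of R^p are row vectors; the library norm `|x| on 'rV[R]_p is the
   sup norm.  Indices j in {1, ..., p} are represented by j : 'I_p, shifted
   by one. *)

Definition lq_norm (R : realType) (p : nat) (q : R) (x : 'rV[R]_p) : R :=
  (\sum_(j < p) `|x 0 j| `^ q) `^ q^-1.

(* On R^p, the product and Borel sigma-algebras coincide, so measurability is
   coordinatewise. *)
Definition random_vector (R : realType) d (T : measurableType d) (p : nat)
    (X : T -> 'rV[R]_p) : Prop :=
  forall j : 'I_p, measurable_fun [set: T] (fun w => X w 0 j).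

(* Meaningful for 0 < u < 1, when the set below is nonempty and bounded below. *)
Definition quantile (R : realType) d (T : measurableType d)
    (P : probability T R) (X : T -> R) (u : R) : R :=
  inf [set t : R | (u%:E <= P [set w | (X w <= t)%R])%E].

Definition is_argmin (R : realType) (V : Type) (F : V -> R) (C : set V)
    (x : V) : Prop :=
  C x /\ forall y, C y -> F x <= F y.

Definition l1_estimator (R : realType) (p : nat) (lambda : R)
    (thetahat thetatilde : 'rV[R]_p) : Prop :=
  is_argmin (@lq_norm R p 1)
    [set theta | `|thetahat - theta| <= lambda] thetatilde.

(* The event where Q holds need not itself be measurable. *)
Definition with_prob_ge (R : realType) d (T : measurableType d)
    (P : probability T R) (u : R) (Q : T -> Prop) : Prop :=
  exists E : set T,
    [/\ measurable E, (u%:E <= P E)%E & forall w, E w -> Q w].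

Definition cond_ES (R : realType) (p : nat) (theta0 : 'rV[R]_p) (s : nat)
    (T : {set 'I_p}) : Prop :=
  #|T| = s /\ forall j, theta0 0 j != 0 -> j \in T.

(* The k-th entry, counted from 0, of (|x_1|, ..., |x_p|) sorted in
   non-increasing order. *)
Definition abs_rearrangement (R : realType) (p : nat) (x : 'rV[R]_p)
    (k : nat) : R :=
  nth 0 (sort (fun u v : R => v <= u) [seq `|x 0 j| | j <- enum 'I_p]) k.

Definition cond_AS (R : realType) (p : nat) (theta0 : 'rV[R]_p) (A a : R) :
    Prop :=
  [/\ 0 < A, 2^-1 < a &
      forall j : 'I_p, abs_rearrangement theta0 j <= A * (j.+1)%:R `^ (- a)].

Definition cond_DM (R : realType) (p : nat) (theta0 : 'rV[R]_p) (K : R) :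
    Prop :=
  0 < K /\ lq_norm 1 theta0 <= K.

(* Main.v *)
Require Import Defs.
From HB Require Import structures.
From mathcomp Require Import all_boot all_order all_algebra.
From mathcomp Require Import all_classical all_reals all_analysis.
From mathcomp Require Import measurable_realfun.
From mathcomp Require Import lra.

Import Order.TTheory GRing.Theory Num.Theory.
Import numFieldNormedType.Exports.

Local Open Scope classical_set_scope.
Local Open Scope ring_scope.

(** Why the theorem is true.  Everything happens on the event
    |thetahat - theta0|_oo <= lambda.  It has probability at least 1 - alpha:
    for every r above the quantile, the distribution function of the error is
    at least 1 - alpha at r, and right continuity carries the bound down to
    lambda [quantile_le].

    On this event no explicit formula for the estimator is needed.  Both the
    objective and the constraint separate over coordinates, so replacing one
    coordinate of thetatilde by the same coordinate of theta0, which is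
    feasible there, cannot decrease the objective; hence
    |thetatilde_j| <= |theta0_j| [l1_estimator_coord_le].  The triangle
    inequality through thetahat gives |thetatilde_j - theta0_j| <= 2 lambda.
    The error x = thetatilde - theta0 thus satisfies, coordinate by coordinate,

      |x_j| <= 2 min(lambda, |theta0_j|),

    and the three rates are deterministic consequences of this bound:
    - dense: |x_j|^q <= (2 lambda)^(q-1) * 2 |theta0_j|, summed over j
      [lq_norm_dense];
    - exactly sparse: at most s coordinates of x are nonzero, each at most
      2 lambda [lq_norm_sparse];
    - approximately sparse: |x_j|^q is at most a nondecreasing function of
      |theta0_j|, so the sum over j may be taken over the rearranged entries
      of theta0.  The s largest ones contribute at most (2 lambda)^q each; the
      others form the tail of a convergent series,
      (2 A)^q * sum_(k > s) k^(-aq) <= (2 A)^q s^(1-aq) / (aq - 1), which is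
      again of order s lambda^q because the choice of s makes
      A <= lambda s^a.  Together,
      |x|_q <= 2 (1 + 1 / (aq - 1))^(1/q) s^(1/q) lambda
      [lq_norm_approx_sparse]. *)

(** * The sup norm and its quantiles *)

Lemma rV_norm_leP (R : realType) (p : nat) (x : 'rV[R]_p) (c : R) :
  0 <= c -> (forall j, `|x 0 j| <= c) <-> `|x| <= c.
Proof.
move=> c0; rewrite -[`|x|]/(mx_norm x) mx_normrE.
split=> [xc|/bigmax_leP[_ xc] j].
  by apply/bigmax_leP; split=> // -[i j] _ /=; rewrite ord1.
exact: (xc (0, j)).
Qed.

Arguments rV_norm_leP {R p x c}.

Lemma measurable_rV_norm (R : realType) (d : measure_display)
    (T : measurableType d) (p : nat) (X : T -> 'rV[R]_p) :
  random_vector X -> measurable_fun [set: T] (fun w => `|X w|).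
Proof.
move=> mX.
have -> : (fun w => `|X w|) =
    (fun w => \big[Num.max/0]_(ij : 'I_1 * 'I_p) `|X w ij.1 ij.2|).
  by apply/funext => w; rewrite -mx_normrE.
elim: index_enum => [|[i j] s IH].
  by under eq_fun do rewrite big_nil; exact: measurable_cst.
under eq_fun do rewrite big_cons /=.
apply: measurable_maxr => //; rewrite ord1.
by apply: measurableT_comp => //; exact: mX.
Qed.

(** Right continuity of the distribution function:
    any r > t exceeds some level where the distribution function has already
    reached u, and r decreases to t.  The assumption u < 1 provides such a
    level: without one, the infimum would be that of the empty set. *)
Lemma quantile_le (R : realType) (d : measure_display)
    (T : measurableType d) (P : probability T R) (X : T -> R) (u t : R) :
  measurable_fun [set: T] X -> u < 1 -> quantile P X u <= t ->
  (u%:E <= P [set w | (X w <= t)%R])%E.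
Proof.
move=> mX u1 qt.
pose X' : {RV P >-> R} := mfun_Sub (mem_set mX : X \in mfun).
have cdfE r : cdf X' r = P [set w | X w <= r] by rewrite -preimage_itvNyc.
rewrite -cdfE; have cvgX : cdf X' r @[r --> t^'+] --> cdf X' t.
  exact: cdf_right_continuous.
apply: (cvge_to_ge cvgX).
near=> r.
have qr : quantile P X u < r.
  by apply: le_lt_trans qt _; near: r; exact: nbhs_right_gt.
have [|y /= uy /ltW yr] := inf_lt _ qr; last first.
  by apply: le_trans uy _; rewrite -cdfE; exact: cdf_nondecreasing.
(* the distribution function tends to 1 > u, so it reaches u somewhere *)
have cvg1 : cdf X' r @[r --> +oo%R] --> 1%E by exact: cvg_cdfy1.
apply: contrapT => /forallNP noS.
suff : (1 <= u%:E)%E by rewrite lee_fin leNgt u1.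
apply: (cvge_to_le cvg1); apply: nearW => y; rewrite cdfE leNgt.
by apply/negP => /ltW; exact: noS.
Unshelve. all: by end_near. Qed.

(** * Shrinkage of the l1 estimator *)

Lemma lq_norm1 (R : realType) (p : nat) (x : 'rV[R]_p) :
  lq_norm 1 x = \sum_(j < p) `|x 0 j|.
Proof.
rewrite /lq_norm invr1 powRr1; last by apply: sumr_ge0 => j _; exact: powR_ge0.
by apply: eq_bigr => j _; rewrite powRr1.
Qed.

(** The competitor theta' moves only the coordinate j of theta, to t: it stays
    in the sup-norm ball, and its l1 norm differs from that of theta only by
    |t| - |theta_j|. *)
Lemma l1_estimator_coord_le (R : realType) (p : nat) (lambda t : R)
    (y theta : 'rV[R]_p) (j : 'I_p) :
  l1_estimator lambda y theta -> `|y 0 j - t| <= lambda ->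
  `|theta 0 j| <= `|t|.
Proof.
move=> [/= ytheta min_theta] yt; have l0 := le_trans (normr_ge0 _) yt.
pose theta' : 'rV[R]_p := \row_k (if k == j then t else theta 0 k).
have ytheta' : `|y - theta'| <= lambda.
  apply/rV_norm_leP => // k; rewrite !mxE; case: eqP => [->//|_].
  by move/(rV_norm_leP l0): ytheta => /(_ k); rewrite !mxE.
have := min_theta _ ytheta'; rewrite !lq_norm1.
rewrite (bigD1 j) //= [X in _ <= X](bigD1 j) //= mxE eqxx.
rewrite [X in _ <= _ + X](eq_bigr (fun k => `|theta 0 k|)) ?lerD2r //.
by move=> k /negPf kj; rewrite mxE kj.
Qed.

(** * Dense and exactly sparse targets *)

Lemma lq_norm_le (R : realType) (p : nat) (q M : R) (x : 'rV[R]_p) :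
  0 < q -> \sum_(j < p) `|x 0 j| `^ q <= M -> lq_norm q x <= M `^ q^-1.
Proof.
move=> q0 xM; have x0 : 0 <= \sum_(j < p) `|x 0 j| `^ q.
  by apply: sumr_ge0 => j _; exact: powR_ge0.
apply: ge0_ler_powR => //; rewrite ?nnegrE ?invr_ge0 ?(ltW q0) //.
exact: le_trans xM.
Qed.

Lemma powRVK (R : realType) (x r : R) :
  0 <= x -> r != 0 -> (x `^ r) `^ r^-1 = x.
Proof. by move=> x0 r0; rewrite -powRrM divff // powRr1. Qed.

(** Interpolation between l_oo and l1: in |x_j|^q = |x_j|^(q-1) |x_j| the
    first factor is bounded uniformly and the second one is summable. *)
Lemma lq_norm_dense (R : realType) (p : nat) (q lambda K : R)
    (x theta : 'rV[R]_p) :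
  1 <= q -> 0 <= lambda ->
  (forall j, `|x 0 j| <= 2 * lambda) ->
  (forall j, `|x 0 j| <= 2 * `|theta 0 j|) ->
  lq_norm 1 theta <= K ->
  lq_norm q x <= 2 * K `^ q^-1 * lambda `^ (1 - q^-1).
Proof.
move=> q1 l0 xl xt tK; have q0 : 0 < q by exact: lt_le_trans q1.
have K0 : 0 <= K by apply: le_trans tK; exact: powR_ge0.
have l20 : 0 <= 2 * lambda by rewrite mulr_ge0.
have -> : 2 * K `^ q^-1 * lambda `^ (1 - q^-1) =
    ((2 * lambda) `^ (q - 1) * (2 * K)) `^ q^-1.
  rewrite powRM ?mulr_ge0 ?powR_ge0 // -powRrM mulrBl mul1r divff ?gt_eqF //.
  rewrite !powRM // mulrACA -powRD; last by rewrite pnatr_eq0 implybT.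
  by rewrite subrK powRr1 // -!mulrA [K `^ _ * _]mulrC.
apply: lq_norm_le => //.
have le_j j : `|x 0 j| `^ q <= (2 * lambda) `^ (q - 1) * (2 * `|theta 0 j|).
  rewrite -mulr_powRB1 // mulrC; apply: ler_pM; rewrite ?powR_ge0 //.
  by apply: ge0_ler_powR; rewrite ?nnegrE ?subr_ge0.
apply: le_trans (ler_sum _ (fun j _ => le_j j)) _.
rewrite -!mulr_sumr ler_wpM2l ?powR_ge0 // ler_wpM2l // -lq_norm1 //.
Qed.

Lemma lq_norm_sparse (R : realType) (p : nat) (q c : R) (x : 'rV[R]_p)
    (T : {set 'I_p}) :
  0 < q -> 0 <= c ->
  (forall j, `|x 0 j| <= c) -> (forall j, j \notin T -> x 0 j = 0) ->
  lq_norm q x <= #|T|%:R `^ q^-1 * c.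
Proof.
move=> q0 c0 xc xT.
have -> : #|T|%:R `^ q^-1 * c = (#|T|%:R * c `^ q) `^ q^-1.
  by rewrite powRM ?powR_ge0 // powRVK ?gt_eqF.
apply: lq_norm_le => //.
rewrite (bigID [in T]) /= addrC big1 ?add0r; last first.
  by move=> j /xT ->; rewrite normr0 powR0 ?gt_eqF.
rewrite mulr_natl -sumr_const; apply: ler_sum => j _.
by apply: ge0_ler_powR; rewrite ?nnegrE ?(ltW q0).
Qed.

(** * Approximately sparse targets *)

Lemma sum_abs_rearrangement (R : realType) (p : nat) (x : 'rV[R]_p)
    (f : R -> R) :
  \sum_(j < p) f `|x 0 j| = \sum_(0 <= k < p) f (abs_rearrangement x k).
Proof.
pose s := [seq `|x 0 j| | j <- enum 'I_p].
pose s' := sort (fun u v : R => v <= u) s.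
have ss' : size s' = p by rewrite size_sort size_map size_enum_ord.
transitivity (\sum_(t <- s) f t); first by rewrite big_map big_enum.
rewrite (perm_big s') /=; last by rewrite perm_sym perm_sort.
by rewrite (big_nth 0) ss'.
Qed.

(** The convex function t^(1-b) lies above its tangent at k+1.  After division
    by (k+1)^(1-b) this reads (k/(k+1))^(1-b) >= 1 + (b-1)/(k+1), which follows
    from exp y >= 1 + y and ln y <= y - 1. *)
Lemma powR_telescope (R : realType) (b : R) (k : nat) : 1 < b -> (0 < k)%N ->
  (b - 1) * k.+1%:R `^ (- b) <= k%:R `^ (1 - b) - k.+1%:R `^ (1 - b).
Proof.
move=> b1 k0.
have k0' : 0 < k%:R :> R by rewrite ltr0n.
have kS0 : 0 < k.+1%:R :> R by rewrite ltr0n.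
have r0 : 0 < k%:R / k.+1%:R :> R by rewrite divr_gt0.
have lnr : ln (k%:R / k.+1%:R) <= - k.+1%:R^-1 :> R.
  have -> : k%:R / k.+1%:R = 1 + - k.+1%:R^-1 :> R.
    have kE : k%:R = k.+1%:R - 1 :> R by rewrite -natr1 addrK.
    by rewrite kE mulrBl divff ?gt_eqF // div1r.
  by apply: le_ln1Dx; rewrite ltrN2 invf_lt1 // ltr1n.
have ratio : 1 + (b - 1) / k.+1%:R <= (k%:R / k.+1%:R) `^ (1 - b).
  rewrite /powR gt_eqF //; apply: le_trans (expR_ge1Dx _).
  rewrite lerD2l -[1 - b]opprB mulNr -mulrN ler_wpM2l ?subr_ge0 ?(ltW b1) //.
  by rewrite lerNr.
have -> : k%:R `^ (1 - b) =
    (k%:R / k.+1%:R) `^ (1 - b) * k.+1%:R `^ (1 - b) :> R.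
  by rewrite -powRM ?divr_ge0 ?ler0n // divfK ?gt_eqF.
have -> : k.+1%:R `^ (- b) = k.+1%:R^-1 * k.+1%:R `^ (1 - b) :> R.
  rewrite -powR_inv1 ?ler0n // -powRD; last by rewrite pnatr_eq0 implybT.
  by rewrite addrA addNr add0r.
rewrite mulrA -[X in _ <= _ - X]mul1r -mulrBl ler_wpM2r ?powR_ge0 //.
by rewrite lerBrDl.
Qed.

Lemma sum_powR_tail (R : realType) (b : R) (s n : nat) : 1 < b -> (0 < s)%N ->
  \sum_(s <= k < n) k.+1%:R `^ (- b) <= s%:R `^ (1 - b) / (b - 1).
Proof.
move=> b1 s0; have b10 : 0 < b - 1 by rewrite subr_gt0.
rewrite ler_pdivlMr // mulrC mulr_sumr.
have [ns|/ltnW sn] := leqP n s; first by rewrite big_geq // powR_ge0.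
rewrite -[leRHS]subr0.
apply: (@le_trans _ _ (s%:R `^ (1 - b) - n%:R `^ (1 - b))); last first.
  by rewrite lerD2l lerN2 powR_ge0.
rewrite -[leRHS]opprB -(telescope_sumr (fun k => k%:R `^ (1 - b) : R)) //.
rewrite -sumrN !big_nat; apply: ler_sum => k /andP[sk _]; rewrite opprB.
by apply: powR_telescope => //; exact: leq_trans sk.
Qed.

(** Index k stands for rank k + 1, so the first s terms are those of rank at
    most s; they are bounded by B and the remaining ones by the power law.  The
    number p of terms may be smaller than s. *)
Lemma sum_trunc_powR (R : realType) (b B D : R) (s p : nat) (g : nat -> R) :
  1 < b -> (0 < s)%N -> 0 <= B -> 0 <= D ->
  (forall k, (k < p)%N -> g k <= B) ->
  (forall k, (k < p)%N -> g k <= D * k.+1%:R `^ (- b)) ->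
  \sum_(0 <= k < p) g k <= s%:R * B + D * (s%:R `^ (1 - b) / (b - 1)).
Proof.
move=> b1 s0 B0 D0 gB gD; pose m := minn s p.
rewrite (@big_cat_nat _ _ _ m) //= ?geq_minr //.
have headB : \sum_(0 <= k < m) g k <= s%:R * B.
  apply: (@le_trans _ _ (m%:R * B)); last first.
    by rewrite ler_wpM2r // ler_nat geq_minl.
  rewrite mulr_natl -[m in leRHS]subn0 -sumr_const_nat !big_nat.
  apply: ler_sum => k /andP[_ km].
  by apply: gB; apply: leq_trans km _; exact: geq_minr.
apply: lerD => //.
have [sp|ps] := leqP s p; last first.
  rewrite /m (minn_idPr (ltnW ps)) big_geq // mulr_ge0 // divr_ge0 ?powR_ge0 //.
  by rewrite subr_ge0 ltW.
rewrite /m (minn_idPl sp).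
apply: (@le_trans _ _ (D * \sum_(s <= k < p) k.+1%:R `^ (- b))); last first.
  by rewrite ler_wpM2l // sum_powR_tail.
by rewrite mulr_sumr !big_nat; apply: ler_sum => k /andP[_ kp]; exact: gD.
Qed.

(** The threshold s is where the power law A k^(-a) falls below lambda; since
    a q > 1, the entries beyond it contribute no more than a constant times
    the s entries before it. *)
Lemma lq_norm_approx_sparse (R : realType) (p s : nat) (q a A lambda : R)
    (x theta : 'rV[R]_p) :
  0 <= lambda -> 0 <= A -> 0 < q -> 1 < a * q -> (0 < s)%N ->
  A <= lambda * s%:R `^ a ->
  (forall j, `|x 0 j| <= 2 * lambda) ->
  (forall j, `|x 0 j| <= 2 * `|theta 0 j|) ->
  (forall j : 'I_p, abs_rearrangement theta j <= A * j.+1%:R `^ (- a)) ->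
  lq_norm q x <=
    2 * (1 + (a * q - 1)^-1) `^ q^-1 * s%:R `^ q^-1 * lambda.
Proof.
move=> l0 A0 q0 aq1 s0 Al xl xt ordA.
have c0 : 0 <= 2 * lambda by rewrite mulr_ge0.
have q0' := ltW q0.
have aq0 : 0 <= 1 + (a * q - 1)^-1.
  by rewrite addr_ge0 // invr_ge0 subr_ge0 ltW.
have -> : 2 * (1 + (a * q - 1)^-1) `^ q^-1 * s%:R `^ q^-1 * lambda =
   (s%:R * (2 * lambda) `^ q * (1 + (a * q - 1)^-1)) `^ q^-1.
  rewrite powRM ?mulr_ge0 ?powR_ge0 ?ler0n // powRM ?powR_ge0 ?ler0n //.
  rewrite powRVK ?gt_eqF // -!mulrA mulrC -!mulrA; lra.
apply: lq_norm_le => //.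
(* nondecreasing on nonnegative reals, so bounds on the rearranged entries of
   theta can be substituted in f *)
pose f (t : R) := Num.min (2 * lambda) (2 * `|t|) `^ q.
have xf j : `|x 0 j| `^ q <= f `|theta 0 j|.
  by apply: ge0_ler_powR; rewrite ?nnegrE ?le_min ?c0 ?mulr_ge0 ?normr_id ?xl
    ?xt.
apply: le_trans (ler_sum _ (fun j _ => xf j)) _.
rewrite sum_abs_rearrangement.
have re0 k : (k < p)%N -> 0 <= abs_rearrangement theta k.
  move=> kp; apply: (@allP _ (fun t : R => 0 <= t) _ _ _ (mem_nth _ _)).
    by rewrite all_sort; apply/allP => _ /mapP[j _ ->].
  by rewrite size_sort size_map size_enum_ord.
apply: le_trans (@sum_trunc_powR _ (a * q) ((2 * lambda) `^ q) ((2 * A) `^ q) s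
  p _ aq1 s0 (powR_ge0 _ _) (powR_ge0 _ _) _ _) _ => [k kp|k kp|].
- by apply: ge0_ler_powR; rewrite ?nnegrE ?le_min ?c0 ?mulr_ge0 ?ge_min ?lexx.
- have -> : (2 * A) `^ q * k.+1%:R `^ (- (a * q)) =
      (2 * (A * k.+1%:R `^ (- a))) `^ q.
    by rewrite mulrA [in RHS]powRM ?mulr_ge0 ?powR_ge0 // -powRrM mulNr.
  apply: ge0_ler_powR;
    rewrite ?nnegrE ?le_min ?c0 ?mulr_ge0 ?powR_ge0 // ge_min.
  apply/orP; right; rewrite ler_wpM2l // ger0_norm ?re0 //.
  exact: (ordA (Ordinal kp)).
- rewrite mulrDr mulr1 lerD2l mulrA ler_wpM2r ?invr_ge0 ?subr_ge0 ?(ltW aq1) //.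
  have s0' : s%:R != 0 :> R by rewrite pnatr_eq0 -lt0n.
  have -> : s%:R * (2 * lambda) `^ q =
      (2 * (lambda * s%:R `^ a)) `^ q * s%:R `^ (1 - a * q) :> R.
    rewrite mulrA [in RHS]powRM ?powR_ge0 // -powRrM -mulrA -powRD; last first.
      by rewrite s0' implybT.
    by rewrite addrC subrK powRr1 ?ler0n // mulrC.
  rewrite ler_wpM2r ?powR_ge0 //; apply: ge0_ler_powR => //.
  + by rewrite nnegrE mulr_ge0.
  + by rewrite nnegrE !mulr_ge0 ?powR_ge0.
  + by rewrite ler_wpM2l.
Qed.

(** The hypothesis on s in [lq_norm_approx_sparse] holds for the rounded-up
    solution of A = lambda s^a. *)
Lemma le_mul_ceil_powR (R : realType) (a A lambda : R) :
  0 < a -> 0 < lambda -> 0 < A ->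
  exists2 s : nat, (Num.ceil ((A / lambda) `^ a^-1) = s%:Z /\ (0 < s)%N) &
    A <= lambda * s%:R `^ a.
Proof.
move=> a0 l0 A0; set r := _ `^ _.
have r0 : 0 < r by rewrite powR_gt0 // divr_gt0.
have : 0 < Num.ceil r by rewrite ceil_gt0.
have := ceil_ge r.
case: (Num.ceil r) => // s; rewrite -pmulrn => rs s0; exists s => //.
rewrite mulrC -ler_pdivrMr //.
have -> : A / lambda = r `^ a.
  by rewrite -powRrM mulVf ?gt_eqF // powRr1 // divr_ge0 ?ltW.
by apply: ge0_ler_powR; rewrite ?nnegrE ?(ltW a0) ?(ltW r0).
Qed.

Theorem theorem2p10 (R : realType) :
  exists C : R -> R -> R,
  forall (d : measure_display) (Omega : measurableType d)
    (P : probability Omega R) (p : nat) (theta0 : 'rV[R]_p)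
    (thetahat thetatilde : Omega -> 'rV[R]_p) (alpha lambda : R),
  random_vector thetahat ->
  0 < alpha < 1 ->
  0 < lambda ->
  quantile P (fun w => `|thetahat w - theta0|) (1 - alpha) <= lambda ->
  (forall w, l1_estimator lambda (thetahat w) (thetatilde w)) ->
  with_prob_ge P (1 - alpha) (fun w =>
    [/\ forall j : 'I_p, `|thetatilde w 0 j| <= `|theta0 0 j| /\
          `|thetatilde w 0 j - theta0 0 j| <= 2 * lambda,
        forall K : R, cond_DM theta0 K ->
          forall q : R, 1 <= q ->
          lq_norm q (thetatilde w - theta0)
            <= 2 * K `^ q^-1 * lambda `^ (1 - q^-1),
        forall (s : nat) (T : {set 'I_p}), cond_ES theta0 s T ->
          (forall q : R, 1 <= q ->
            lq_norm q (thetatilde w - theta0) <= 2 * s%:R `^ q^-1 * lambda) /\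
          (forall j : 'I_p, j \notin T -> thetatilde w 0 j = 0)
      & forall A a : R, cond_AS theta0 A a ->
          forall q : R, a^-1 < q ->
          let s : int := Num.ceil ((A / lambda) `^ a^-1) in
          lq_norm q (thetatilde w - theta0)
            <= C a q * s%:~R `^ q^-1 * lambda]).
Proof.
exists (fun a q => 2 * (1 + (a * q - 1)^-1) `^ q^-1).
move=> d Omega P p theta0 thetahat thetatilde alpha lambda mhat.
move=> /andP[alpha0 _] l0 quantl est; have l0' := ltW l0.
have mX : measurable_fun [set: Omega] (fun w => `|thetahat w - theta0|).
  apply: measurable_rV_norm => j; under eq_fun do rewrite !mxE.
  by apply: measurable_funB => //; exact: mhat.
exists [set w | `|thetahat w - theta0| <= lambda]; split=> [||w /= Ew].
- by rewrite -preimage_itvNyc -[X in measurable X]setTI; exact: mX.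
- by apply: quantile_le => //; rewrite gtrBl.
have E_j j : `|thetahat w 0 j - theta0 0 j| <= lambda.
  by move/(rV_norm_leP l0'): Ew => /(_ j); rewrite !mxE.
have shrink j : `|thetatilde w 0 j| <= `|theta0 0 j|.
  exact: l1_estimator_coord_le (est w) (E_j j).
have close j : `|thetatilde w 0 j - theta0 0 j| <= 2 * lambda.
  have [/= /(rV_norm_leP l0') /(_ j) feas _] := est w.
  rewrite !mxE distrC in feas; have := ler_distD (thetahat w 0 j)
    (thetatilde w 0 j) (theta0 0 j).
  by move: (E_j j) feas; lra.
have xl j : `|(thetatilde w - theta0) 0 j| <= 2 * lambda by rewrite !mxE.
have xt j : `|(thetatilde w - theta0) 0 j| <= 2 * `|theta0 0 j|.
  rewrite !mxE; apply: le_trans (ler_normB _ _) _.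
  by move: (shrink j); lra.
split=> [j|K [_ tK] q q1|s T [<- tT]|A a [A0 a2 ordA] q aq /=].
- by split.
- exact: lq_norm_dense l0' xl xt tK.
- have tilde0 j : j \notin T -> thetatilde w 0 j = 0.
    move=> jT; apply/eqP; rewrite -normr_le0; apply: le_trans (shrink j) _.
    by rewrite normr_le0; apply: contraNT jT; exact: tT.
  split=> // q q1; rewrite mulrAC mulrC.
  apply: lq_norm_sparse => //; [exact: lt_le_trans q1|exact: mulr_ge0|].
  move=> j jT; rewrite !mxE tilde0 // sub0r.
  by apply/eqP; rewrite oppr_eq0; apply: contraNT jT; exact: tT.
- have a0 : 0 < a by apply: lt_trans a2; rewrite invr_gt0.
  have q0 : 0 < q by apply: lt_trans aq; rewrite invr_gt0.
  have [s [-> s0] As] := @le_mul_ceil_powR _ a A lambda a0 l0 A0.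
  rewrite -pmulrn.
  apply: lq_norm_approx_sparse l0' (ltW A0) q0 _ s0 As xl xt ordA.
  by rewrite mulrC -ltr_pdivrMr ?div1r.
Qed.
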